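(* Let $\bm{A}$ be an $n\times n$ matrix over $\mathbb{R}_{\max,\times}$ (that is, with nonnegative real entries) such that the matrix $\bm{B}=\bm{A}\oplus\bm{A}^{-}$ has no zero entries, let $\mu$ be the spectral radius of $\bm{B}$, and let $\bm{C}$ be an $n\times n$ matrix over $\mathbb{R}_{\max,\times}$ such that $\mathrm{Tr}(\bm{C})\leq 1$. Consider the problem of minimizing $\rho(\bm{A},\bm{x}\bm{x}^{-})$ over all regular column vectors $\bm{x}$ with $n$ entries (that is, $\bm{x}\in\mathbb{R}_{+}^{n}$) subject to the constraint $\bm{C}\bm{x}\leq\bm{x}$. Then the minimum value in this problem is equal to $$\theta=\mu\oplus\bigoplus_{k=1}^{n-1}\ \bigoplus_{1\leq i_{1}+\cdots+i_{k}\leq n-k}\mathrm{tr}^{1/k}(\bm{B}\bm{C}^{i_{1}}\cdots\bm{B}\bm{C}^{i_{k}}),$$ where the inner sum is over all nonnegative integers $i_1,\ldots,i_k$ satisfying the indicated inequalities, and all regular solutions (the regular vectors satisfying the constraint and attaining the minimum) are given by $$\bm{x}=(\theta^{-1}\bm{B}\oplus\bm{C})^{\ast}\bm{u},\qquad \bm{u}\in\mathbb{R}_{+}^{n}.$$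
   Context: Semifield: $\mathbb{R}_{+}=\{x\in\mathbb{R}\mid x>0\}$, and $\mathbb{R}_{\max,\times}=(\mathbb{R}_{+}\cup\{0\},\max,\times,0,1)$ is the idempotent semifield of nonnegative reals in which addition is $x\oplus y=\max(x,y)$, multiplication is the usual multiplication, the zero is $0$ and the unit is $1$; inverses, powers (including rational exponents) and the order are the usual ones. The symbol $\bigoplus$ denotes an iterated $\oplus$, i.e. a maximum (an empty one being $0$). Vectors and matrices: all vector and matrix sums and products are computed with $\oplus=\max$ in place of $+$ and with the usual multiplication; e.g. $(\bm{A}\oplus\bm{B})_{ij}=\max(a_{ij},b_{ij})$, $(\bm{A}\bm{B})_{ij}=\max_k a_{ik}b_{kj}$, and $(\bm{C}\bm{x})_i=\max_j c_{ij}x_j$. Vector inequalities are entrywise. A vector is regular if it has no zero entries. For a column vector $\bm{x}=(x_i)$, $\bm{x}^{-}$ is the row vector with entries $x_i^{-1}$ if $x_i\neq 0$ and $0$ otherwise; so for regular $\bm{x}$, $\bm{x}\bm{x}^{-}$ is the $n\times n$ matrix with entries $x_i/x_j$. For a matrix $\bm{A}=(a_{ij})$, $\bm{A}^{-}$ is the matrix whose $(i,j)$ entry is $a_{ji}^{-1}$ if $a_{ji}\neq 0$ and $0$ otherwise. $\bm{I}$ is the identity matrix ($1$ on the diagonal and $0$ elsewhere), $\bm{A}^{0}=\bm{I}$, $\bm{A}^{p}=\bm{A}^{p-1}\bm{A}$. The trace is $\mathrm{tr}\,\bm{A}=a_{11}\oplus\cdots\oplus a_{nn}=\max_i a_{ii}$;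 $\mathrm{tr}^{1/k}(\bm{A})$ denotes $(\mathrm{tr}\,\bm{A})^{1/k}$; and $\mathrm{Tr}(\bm{A})=\mathrm{tr}\,\bm{A}\oplus\cdots\oplus\mathrm{tr}\,\bm{A}^{n}$ for an $n\times n$ matrix $\bm{A}$. Approximation error (Chebyshev-like distance): $\rho(\bm{A},\bm{B})=\mathrm{tr}(\bm{B}^{-}\bm{A})\oplus\mathrm{tr}(\bm{A}^{-}\bm{B})$. Spectral radius: the spectral radius of an $n\times n$ matrix $\bm{A}=(a_{ij})$ is its maximum eigenvalue in the max-times sense (a scalar $\lambda$ with $\bm{A}\bm{x}=\lambda\bm{x}$ for some nonzero vector $\bm{x}$), calculated as $\lambda=\bigoplus_{k=1}^{n}\mathrm{tr}^{1/k}(\bm{A}^{k})=\max_{1\le k\le n}\ \max_{1\le i_1,\ldots,i_k\le n}(a_{i_1i_2}a_{i_2i_3}\cdots a_{i_ki_1})^{1/k}$. Kleene star: for an $n\times n$ matrix $\bm{A}$ with $\mathrm{Tr}(\bm{A})\le 1$, $\bm{A}^{\ast}=\bm{I}\oplus\bm{A}\oplus\cdots\oplus\bm{A}^{n-1}$. *)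

(* Defs.v *)
From HB Require Import structures.
From mathcomp Require Import all_boot all_order all_algebra.
From mathcomp Require Import reals exp.
Set Implicit Arguments.
Unset Strict Implicit.
Unset Printing Implicit Defensive.
Import Order.TTheory GRing.Theory Num.Theory.
Local Open Scope ring_scope.

(* The idempotent semifield of nonnegative reals (max, times).  It is an
   instance of the semiring interface, so that in ring_scope, at this type,
   [x + y] is the maximum, [x * y] the usual product, [\sum] an iterated
   maximum ([0] when empty), and the matrix operations [A + B], [A *m B],
   [a *: A], [A ^+ k], [\tr A], [1%:M] over it are the max-times ones. *)
Record maxtimes (R : realType) := MaxTimes { mtval : R; mtval_ge0 : 0 <= mtval }.

HB.instance Definition _ (R : realType) := [isSub for @mtval R].
HB.instance Definition _ (R : realType) := [Choice of maxtimes R by <:].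
HB.instance Definition _ (R : realType) :=
  [SubChoice_isSubOrder of maxtimes R by <: with ring_display].

Section Semifield.
Variable R : realType.
Implicit Types x y z : maxtimes R.

Lemma mt_add_subproof x y : 0 <= Num.max (mtval x) (mtval y).
Proof. by rewrite le_max mtval_ge0. Qed.

Lemma mt_mul_subproof x y : 0 <= mtval x * mtval y.
Proof. by rewrite mulr_ge0 ?mtval_ge0. Qed.

Lemma mt_inv_subproof x : 0 <= (mtval x)^-1.
Proof. by rewrite invr_ge0 mtval_ge0. Qed.

Definition mt_zero : maxtimes R := MaxTimes (lexx 0).
Definition mt_one : maxtimes R := MaxTimes ler01.
Definition mt_add x y := MaxTimes (mt_add_subproof x y).
Definition mt_mul x y := MaxTimes (mt_mul_subproof x y).

Lemma mt_addA : associative mt_add.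
Proof. by move=> x y z; apply: val_inj; rewrite /= maxA. Qed.

Lemma mt_addC : commutative mt_add.
Proof. by move=> x y; apply: val_inj; rewrite /= maxC. Qed.

Lemma mt_add0 : left_id mt_zero mt_add.
Proof. by move=> x; apply: val_inj; rewrite /= max_r ?mtval_ge0. Qed.

HB.instance Definition _ := GRing.isNmodule.Build (maxtimes R)
  mt_addA mt_addC mt_add0.

Lemma mt_mulA : associative mt_mul.
Proof. by move=> x y z; apply: val_inj; rewrite /= mulrA. Qed.

Lemma mt_mulC : commutative mt_mul.
Proof. by move=> x y; apply: val_inj; rewrite /= mulrC. Qed.

Lemma mt_mul1 : left_id mt_one mt_mul.
Proof. by move=> x; apply: val_inj; rewrite /= mul1r. Qed.

Lemma mt_mulDl : left_distributive mt_mul +%R.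
Proof. by move=> x y z; apply: val_inj; rewrite /= maxr_pMl ?mtval_ge0. Qed.

Lemma mt_mul0 : left_zero 0 mt_mul.
Proof. by move=> x; apply: val_inj; rewrite /= mul0r. Qed.

Lemma mt_one_neq0 : mt_one != 0.
Proof. by rewrite -val_eqE /= oner_neq0. Qed.

HB.instance Definition _ := GRing.Nmodule_isComNzSemiRing.Build (maxtimes R)
  mt_mulA mt_mulC mt_mul1 mt_mulDl mt_mul0 mt_one_neq0.

(* [mt_inv 0 = 0], inherited from [0^-1 = 0] in a field. *)
Definition mt_inv x := MaxTimes (mt_inv_subproof x).

Definition mt_root (k : nat) x := MaxTimes (powR_ge0 (mtval x) k%:R^-1).

Lemma mtval0 : mtval (0 : maxtimes R) = 0. Proof. by []. Qed.
Lemma mtval1 : mtval (1 : maxtimes R) = 1. Proof. by []. Qed.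
Lemma mtvalD x y : mtval (x + y) = Num.max (mtval x) (mtval y).
Proof. by []. Qed.
Lemma mtvalM x y : mtval (x * y) = mtval x * mtval y. Proof. by []. Qed.
Lemma mtval_le x y : (x <= y) = (mtval x <= mtval y). Proof. by []. Qed.

End Semifield.

Section Matrices.
Variable R : realType.

(* Multiplicative conjugate transpose: zero entries stay zero by [mt_inv 0 = 0].
   On a column vector it gives the row vector of inverses. *)
Definition mconj m n (A : 'M[maxtimes R]_(m, n)) : 'M[maxtimes R]_(n, m) :=
  \matrix_(i, j) mt_inv (A j i).

Definition no_zero_entry m n (A : 'M[maxtimes R]_(m, n)) : Prop :=
  forall i j, A i j != 0.

Definition regular n (x : 'cV[maxtimes R]_n) : Prop := no_zero_entry x.

Definition entrywise_le m n (A B : 'M[maxtimes R]_(m, n)) : Prop :=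
  forall i j, A i j <= B i j.

Definition Tr n (A : 'M[maxtimes R]_n) : maxtimes R :=
  \sum_(1 <= k < n.+1) \tr (A ^+ k).

Definition rho n (A B : 'M[maxtimes R]_n) : maxtimes R :=
  \tr (mconj B *m A) + \tr (mconj A *m B).

Definition mt_eigenvalue n (A : 'M[maxtimes R]_n) (l : maxtimes R) : Prop :=
  exists2 x : 'cV[maxtimes R]_n, x != 0 & A *m x = l *: x.

Definition is_spectral_radius n (A : 'M[maxtimes R]_n) (mu : maxtimes R) : Prop :=
  mt_eigenvalue A mu /\ forall l, mt_eigenvalue A l -> l <= mu.

(* Only meaningful when [Tr A <= 1]. *)
Definition kleene_star n (A : 'M[maxtimes R]_n) : 'M[maxtimes R]_n :=
  \sum_(k < n) A ^+ k.

(* The exponents i_1, ..., i_k are natural numbers whose sum is at most n - k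
   with k >= 1, so each of them is below n: ranging over ['I_n] loses nothing.
   The matrix product is taken in the order of the tuple. *)
Definition theta n (mu : maxtimes R) (B C : 'M[maxtimes R]_n) : maxtimes R :=
  mu + \sum_(1 <= k < n)
         \sum_(i : k.-tuple 'I_n | (1 <= \sum_(e <- i) e <= n - k)%N)
           mt_root k (\tr (\prod_(e <- i) (B *m C ^+ e))).

End Matrices.

Definition is_minimum (R : realType) (T : Type) (S : T -> Prop)
    (f : T -> maxtimes R) (m : maxtimes R) : Prop :=
  (exists2 x, S x & f x = m) /\ (forall x, S x -> m <= f x).

(* Main.v *)
(* For regular x, rho(A, x x^-) = x^- B x, and x^- B x <= t is equivalent to
   B x <= t x. Together with C x <= x this reads (t^-1 B + C) x <= x, whose
   regular solutions are the vectors (t^-1 B + C)^* u as soon as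
   Tr (t^-1 B + C) <= 1: repeated vertices in a walk of length n bound a cycle
   of weight at most 1, so the n-th power lies below the star. Expanding
   Tr (t^-1 B + C) into words in B and C and rotating each word cyclically so
   that it begins with B shows that the trace condition holds at t = theta;
   conversely, every feasible x forces each term of theta below x^- B x. *)
Require Import Defs.
From mathcomp Require Import all_boot all_order all_algebra.
From mathcomp Require Import reals exp zify.
Set Implicit Arguments.
Unset Strict Implicit.
Import Order.TTheory GRing.Theory Num.Theory.
Local Open Scope ring_scope.

(** * Order and arithmetic of the max-times semifield *)

Section MaxTimes.
Variable R : realType.
Implicit Types x y z b : maxtimes R.

Lemma mt_ge0 x : (0 : maxtimes R) <= x. Proof. exact: mtval_ge0. Qed.

Lemma mt_addE x y : (x <= y) <-> (x + y = y).
Proof.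
rewrite mtval_le; split=> [h|<-]; last by rewrite mtvalD le_max lexx.
by apply: val_inj; rewrite /= max_r.
Qed.

Lemma mt_add_le x y b : (x + y <= b) = (x <= b) && (y <= b).
Proof. by rewrite !mtval_le mtvalD ge_max. Qed.

Lemma mt_le_addl x y : x <= x + y.
Proof. by rewrite mtval_le mtvalD le_max lexx. Qed.

Lemma mt_le_addr x y : y <= x + y.
Proof. by rewrite mtval_le mtvalD le_max lexx orbT. Qed.

Lemma mt_leM x x' y y' : x <= x' -> y <= y' -> x * y <= x' * y'.
Proof. by rewrite !mtval_le !mtvalM => *; rewrite ler_pM ?mtval_ge0. Qed.

Lemma mt_mulVx x : x != 0 -> mt_inv x * x = 1.
Proof. by move=> x0; apply: val_inj; rewrite /= mulVf. Qed.

Lemma mt_mul_neq0 x y : (x * y != 0) = (x != 0) && (y != 0).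
Proof. by rewrite -!val_eqE /= mulf_eq0 negb_or. Qed.

Lemma mt_inv_neq0 x : (mt_inv x != 0) = (x != 0).
Proof. by rewrite -!val_eqE /= invr_eq0. Qed.

Lemma mt_invM x y : mt_inv (x * y) = mt_inv x * mt_inv y.
Proof. by apply: val_inj; rewrite /= invfM. Qed.

Lemma mt_invK x : mt_inv (mt_inv x) = x.
Proof. by apply: val_inj; rewrite /= invrK. Qed.

Lemma mt_neq0_le x y : x <= y -> x != 0 -> y != 0.
Proof.
by move=> xy; apply: contraNN => /eqP y0; rewrite eq_le mt_ge0 -y0 xy.
Qed.

Lemma mt_le_mul2r z x y : z != 0 -> (x * z <= y * z) = (x <= y).
Proof.
move=> z0; apply/idP/idP => h; last exact: mt_leM.
rewrite -[x]mulr1 -[y]mulr1 -(mt_mulVx z0) [mt_inv z * z]mulrC !mulrA.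
exact: mt_leM.
Qed.

Lemma mt_sum_le (I : Type) (r : seq I) (P : pred I) (F : I -> maxtimes R) b :
  (forall i, P i -> F i <= b) -> \sum_(i <- r | P i) F i <= b.
Proof.
move=> h; apply: (big_ind (fun s => s <= b)) => //; first exact: mt_ge0.
by move=> x y xb yb; rewrite mt_add_le xb.
Qed.

Lemma mt_le_sum (I : eqType) (r : seq I) (P : pred I) (F : I -> maxtimes R) i :
  i \in r -> P i -> F i <= \sum_(j <- r | P j) F j.
Proof.
by move=> ir Pi; rewrite (big_rem i ir) /= Pi; exact: mt_le_addl.
Qed.

Lemma mtvalX x k : mtval (x ^+ k) = mtval x ^+ k.
Proof. by elim: k => // k IH; rewrite !exprS mtvalM IH. Qed.

(** Trades every root in [theta] for a power, so that real exponents do not appear afterwards. *)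
Lemma mt_root_le k x y : (0 < k)%N -> (mt_root k x <= y) = (x <= y ^+ k).
Proof.
move=> k0; rewrite !mtval_le mtvalX /=.
rewrite -(ler_pXn2r k0) ?nnegrE ?powR_ge0 ?mtval_ge0 //.
rewrite -[(_ `^ _) ^+ k]powR_mulrn ?powR_ge0 // -powRrM mulVf ?pnatr_eq0 -?lt0n //.
by rewrite powRr1 ?mtval_ge0.
Qed.

Lemma mt_expr_le x y k : x <= y -> x ^+ k <= y ^+ k.
Proof. by move=> xy; elim: k => // k IH; rewrite !exprS mt_leM. Qed.

End MaxTimes.

(** * Entrywise order, traces and subeigenvectors *)

Section EntrywiseOrder.
Variable R : realType.

(** Addition is idempotent, so the order is an equation; monotonicity of matrix products then
    follows from distributivity. *)
Lemma entrywise_leE m n (A B : 'M[maxtimes R]_(m, n)) :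
  entrywise_le A B <-> A + B = B.
Proof.
split=> [h|h i j]; last by apply/mt_addE; rewrite -{2}h mxE.
by apply/matrixP => i j; rewrite mxE; apply/mt_addE.
Qed.

Lemma entrywise_le_trans m n (A B D : 'M[maxtimes R]_(m, n)) :
  entrywise_le A B -> entrywise_le B D -> entrywise_le A D.
Proof. by move=> AB BD i j; exact: le_trans (AB i j) (BD i j). Qed.

Lemma entrywise_le_anti m n (A B : 'M[maxtimes R]_(m, n)) :
  entrywise_le A B -> entrywise_le B A -> A = B.
Proof.
by move=> AB BA; apply/matrixP => i j; apply/le_anti; rewrite AB BA.
Qed.

Lemma entrywise_leMl m n p (A : 'M[maxtimes R]_(m, n))
    (B D : 'M[maxtimes R]_(n, p)) :
  entrywise_le B D -> entrywise_le (A *m B) (A *m D).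
Proof.
by move/entrywise_leE => h; apply/entrywise_leE; rewrite -mulmxDr h.
Qed.

Lemma entrywise_leMr m n p (A B : 'M[maxtimes R]_(m, n))
    (D : 'M[maxtimes R]_(n, p)) :
  entrywise_le A B -> entrywise_le (A *m D) (B *m D).
Proof.
by move/entrywise_leE => h; apply/entrywise_leE; rewrite -mulmxDl h.
Qed.

Lemma entrywise_leZ m n a (A B : 'M[maxtimes R]_(m, n)) :
  entrywise_le A B -> entrywise_le (a *: A) (a *: B).
Proof. by move=> AB i j; rewrite !mxE mt_leM. Qed.

Lemma entrywise_add_le m n (A B D : 'M[maxtimes R]_(m, n)) :
  entrywise_le (A + B) D <-> entrywise_le A D /\ entrywise_le B D.
Proof.
split=> [h|[h1 h2] i j]; last by rewrite mxE mt_add_le h1 h2.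
by split=> i j; move: (h i j); rewrite mxE mt_add_le => /andP[].
Qed.

Lemma entrywise_sum_le (I : Type) (r : seq I) (P : pred I) m n
    (F : I -> 'M[maxtimes R]_(m, n)) D :
  (forall i, P i -> entrywise_le (F i) D) ->
  entrywise_le (\sum_(i <- r | P i) F i) D.
Proof.
by move=> h i j; rewrite summxE; apply: mt_sum_le => k Pk; exact: h.
Qed.

Lemma mulmx_entry_le m n p (A : 'M[maxtimes R]_(m, n))
    (B : 'M[maxtimes R]_(n, p)) i j k :
  A i j * B j k <= (A *m B) i k.
Proof.
rewrite mxE.
exact: (@mt_le_sum _ _ _ xpredT (fun j => A i j * B j k)) (mem_index_enum _) _.
Qed.

Lemma le_mxtrace n (A : 'M[maxtimes R]_n) i : A i i <= \tr A.
Proof. exact: (@mt_le_sum _ _ _ xpredT (fun i => A i i)) (mem_index_enum _) _. Qed.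

Lemma mxtrace_expr_le_Tr n (A : 'M[maxtimes R]_n) k :
  (0 < k <= n)%N -> \tr (A ^+ k) <= Tr A.
Proof.
move=> hk; apply: (@mt_le_sum _ _ _ xpredT (fun k => \tr (A ^+ k))) => //.
by rewrite mem_index_iota ltnS.
Qed.

(** On the diagonal, [A i i * x i 0 <= (A *m x) i 0 <= a * x i 0], and the nonzero entry of [x]
    cancels. *)
Lemma mxtrace_le_subeigen n (A : 'M[maxtimes R]_n) (x : 'cV_n) a :
  regular x -> entrywise_le (A *m x) (a *: x) -> \tr A <= a.
Proof.
move=> xreg h; apply: mt_sum_le => i _.
rewrite -(mt_le_mul2r _ _ (xreg i 0)).
by apply: le_trans (mulmx_entry_le _ _ _ _ _) _; rewrite (le_trans (h i 0)) ?mxE.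
Qed.

Lemma expr_subeigen n (A : 'M[maxtimes R]_n) (x : 'cV_n) a k :
  entrywise_le (A *m x) (a *: x) -> entrywise_le (A ^+ k *m x) (a ^+ k *: x).
Proof.
move=> h; elim: k => [|k IH]; first by rewrite !expr0 mul1mx scale1r.
rewrite exprSr -[_ * _]/(_ *m _) -mulmxA.
apply: entrywise_le_trans (entrywise_leMl _ h) _.
rewrite -scalemxAr exprS -scalerA; exact: entrywise_leZ.
Qed.

End EntrywiseOrder.

(** * Walks, the Kleene star and the inequality [D *m x <= x] *)

Section KleeneStar.
Variables (R : realType) (n : nat) (D : 'M[maxtimes R]_n).
Implicit Types (i j : 'I_n) (p : seq 'I_n).

(** The start [i] is kept apart from the later vertices [p], so [size p] is the number of edges. *)
Fixpoint walk_weight i p : maxtimes R :=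
  if p is j :: p' then D i j * walk_weight j p' else 1.

Lemma walk_weight_cat i p q :
  walk_weight i (p ++ q) = walk_weight i p * walk_weight (last i p) q.
Proof. by elim: p i => [|j p IH] i /=; rewrite ?mul1r // IH mulrA. Qed.

Lemma walk_weight_le i p : walk_weight i p <= (D ^+ size p) i (last i p).
Proof.
elim: p i => [|j p IH] i /=; first by rewrite expr0 mxE eqxx.
rewrite exprS; apply: le_trans _ (mulmx_entry_le _ _ _ j _).
exact: mt_leM.
Qed.

(* The factor [c] accumulates the weight of the walk already traversed. *)
Lemma expr_entry_le k i j c b :
  (forall p, size p = k -> last i p = j -> c * walk_weight i p <= b) ->
  c * (D ^+ k) i j <= b.
Proof.
elim: k i c => [|k IH] i c h.
  rewrite expr0 mxE; have [ij|] := eqVneq i j; last by rewrite mulr0 mt_ge0.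
  exact: (h [::]).
rewrite exprS mxE mulr_sumr; apply: mt_sum_le => l _.
rewrite mulrA; apply: IH => p sp lp.
by have := h (l :: p); rewrite /= mulrA; apply=> //; rewrite sp.
Qed.

(** Either the start [i] recurs in [p], which is cut at that occurrence, or the repetition lies in
    the tail. The piece [p2] is a closed walk. *)
Lemma walk_cycle i p :
  ~~ uniq (i :: p) -> exists p1 p2 p3 : seq 'I_n,
    [/\ p = p1 ++ p2 ++ p3, (0 < size p2)%N & last (last i p1) p2 = last i p1].
Proof.
elim: p i => [//|j p IH] i; rewrite cons_uniq negb_and negbK => /orP[|/IH].
  move=> /path.splitP[p1 p2]; exists [::], (rcons p1 i), p2.
  by rewrite size_rcons last_rcons.
by case=> p1 [p2] [p3] [-> s2 e]; exists (j :: p1), p2, p3.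
Qed.

Lemma expr_le_kleene_star k : (k < n)%N -> entrywise_le (D ^+ k) (kleene_star D).
Proof.
move=> kn i j; rewrite summxE.
exact: (@mt_le_sum _ _ _ xpredT (fun k : 'I_n => (D ^+ k) i j) (Ordinal kn))
  (mem_index_enum _) _.
Qed.

Hypothesis TrD : Tr D <= 1.

Lemma expr_dim_le_kleene_star : entrywise_le (D ^+ n) (kleene_star D).
Proof.
move=> i j; rewrite -[_ i j]mul1r; apply: expr_entry_le => p sp lp.
(* Pigeonhole: a walk with [n] edges visits [n + 1] vertices. *)
rewrite mul1r; have: ~~ uniq (i :: p).
  apply/negP => /card_uniqP e; have := max_card (mem (i :: p)).
  by rewrite e /= sp card_ord ltnn.
case/walk_cycle => p1 [p2] [p3] [ep s2 e].
move: sp lp; rewrite ep !size_cat !last_cat e => sp lp.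
(* The cycle has between 1 and [n] edges, so its weight is bounded by a trace occurring in
   [Tr D]. *)
have cyc : walk_weight (last i p1) p2 <= 1.
  apply: le_trans (walk_weight_le _ _) _; rewrite e.
  apply: le_trans (le_mxtrace _ _) (le_trans (mxtrace_expr_le_Tr _ _) TrD).
  lia.
rewrite !walk_weight_cat e.
(* Deleting the cycle does not lower the weight, and leaves a walk with the same ends and fewer than
   [n] edges. *)
apply: (@le_trans _ _ (walk_weight i (p1 ++ p3))).
  by rewrite walk_weight_cat mt_leM // -[X in _ <= X]mul1r mt_leM.
apply: le_trans (walk_weight_le _ _) _; rewrite last_cat lp.
apply: expr_le_kleene_star.
rewrite size_cat; lia.
Qed.

Lemma mul_kleene_star_le : entrywise_le (D *m kleene_star D) (kleene_star D).
Proof.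
rewrite {1}/kleene_star mulmx_sumr; apply: entrywise_sum_le => k _.
rewrite -[D *m _]/(D * _) -exprS.
(* Only the last summand, once multiplied by [D], leaves the range of the star; it becomes
   [D ^+ n]. *)
have := ltn_ord k; rewrite leq_eqVlt => /orP[/eqP ->|kn].
  exact: expr_dim_le_kleene_star.
exact: expr_le_kleene_star.
Qed.

Lemma le_kleene_star_mul (u : 'cV_n) : entrywise_le u (kleene_star D *m u).
Proof.
move=> i j; rewrite -[u in X in X <= _]mul1mx.
(* The index [i] forces [n > 0], so the star contains the identity [D ^+ 0]. *)
have n0 : (0 < n)%N by exact: leq_ltn_trans (ltn_ord i).
exact: entrywise_leMr (expr_le_kleene_star n0) _ _.
Qed.

(** A solution is its own parameter: [D *m x <= x] gives [D ^+ k *m x <= x] for all [k], hence the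
    star fixes [x]. Conversely, [D] times the star lies below the star. *)
Lemma kleene_star_solutions (x : 'cV_n) :
  (regular x /\ entrywise_le (D *m x) x) <->
  (exists2 u : 'cV_n, regular u & x = kleene_star D *m u).
Proof.
split=> [[xreg Dx]|[u ureg ->]].
  exists x => //; apply: entrywise_le_anti; first exact: le_kleene_star_mul.
  rewrite /kleene_star mulmx_suml; apply: entrywise_sum_le => k _.
  by have := @expr_subeigen _ _ D x 1 k; rewrite expr1n !scale1r; apply.
split=> [i j|]; first exact: mt_neq0_le (le_kleene_star_mul u i j) (ureg i j).
by rewrite mulmxA; apply: entrywise_leMr; exact: mul_kleene_star_le.
Qed.

End KleeneStar.

(** * Noncommutative words and cyclic rotation under the trace *)

Section Words.
Variables (R : realType) (n : nat).
Implicit Types (P Q B C : 'M[maxtimes R]_n).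

Definition word P Q (w : seq bool) : 'M[maxtimes R]_n :=
  \prod_(b <- w) (if b then P else Q).

Lemma mxtrace_expr_add_le P Q k b :
  (forall w, size w = k -> \tr (word P Q w) <= b) -> \tr ((P + Q) ^+ k) <= b.
Proof.
(* Generalized for induction: [w] records the letters already chosen, [m] counts the factors still
   to be expanded. *)
move=> h; suff: forall m w, (size w + m = k)%N ->
    \tr (word P Q w * (P + Q) ^+ m) <= b.
  by move=> /(_ k [::] erefl); rewrite /word big_nil mul1r.
elim=> [|m IH] w sw; first by rewrite expr0 mulr1 h // -sw addn0.
rewrite exprS mulrDl mulrDr mxtraceD mt_add_le.
have step c : \tr (word P Q w * ((if c then P else Q) * (P + Q) ^+ m)) <= b.
  have := IH (rcons w c); rewrite /word big_rcons /= mulrA; apply.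
  by rewrite size_rcons addSnnS.
by rewrite (step true) (step false).
Qed.

Lemma mxtrace_word_rot P Q w1 w2 :
  \tr (word P Q (w1 ++ w2)) = \tr (word P Q (w2 ++ w1)).
Proof. by rewrite /word !big_cat /=; exact: mxtrace_mulC. Qed.

(** Cut before each [P]: a block is one [P] with the run of [Q] after it, and [e0] counts the [Q]
    preceding the first [P]. *)
Lemma word_blocks P Q w : exists e0 (e : seq nat),
  word P Q w = Q ^+ e0 * \prod_(i <- e) (P * Q ^+ i) /\
  (size w = e0 + (size e + \sum_(i <- e) i))%N.
Proof.
elim: w => [|c w [e0 [e [we sw]]]].
  by exists 0%N, [::]; rewrite /word !big_nil mulr1.
case: c; rewrite /word big_cons -/(word P Q w) we.
  exists 0%N, (e0 :: e); rewrite !big_cons /= expr0 mul1r mulrA; split=> //.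
  by rewrite sw !addnA addnC addnCA !addnA add0n; lia.
exists e0.+1, e; rewrite exprS mulrA; split=> //=.
by rewrite sw.
Qed.

Lemma mxtrace_word P Q w : exists (e : seq nat),
  (e = [::] /\ \tr (word P Q w) = \tr (Q ^+ size w)) \/
  [/\ e != [::], \tr (word P Q w) = \tr (\prod_(i <- e) (P * Q ^+ i)) &
    size w = (size e + \sum_(i <- e) i)%N].
Proof.
have [/path.splitPr[w1 w2]|tw] := boolP (true \in w).
  (* Rotate so that the chosen [P] comes first; the leading run of [w2 ++ w1], of length [e0], then
     completes the block of this [P]. *)
  have [e0 [e [we sw]]] := word_blocks P Q (w2 ++ w1).
  exists (e0 :: e); right; split=> //.
    by rewrite mxtrace_word_rot big_cons -mulrA -we /word cat_cons big_cons.
  move: sw; rewrite !size_cat big_cons /=; lia.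
exists [::]; left; split=> //; congr (\tr _).
rewrite /word; elim: w tw => [|[] w IH] //; first by rewrite big_nil.
by rewrite inE /= => /IH e; rewrite big_cons e exprS.
Qed.

Lemma prod_scale_block a B C (e : seq nat) :
  \prod_(i <- e) (a *: B * C ^+ i) =
  a ^+ size e *: \prod_(i <- e) (B * C ^+ i).
Proof.
elim: e => [|i e IH]; first by rewrite !big_nil scale1r.
rewrite !big_cons IH.
rewrite -[LHS]/((a *: B *m C ^+ i) *m (a ^+ size e *: _)).
by rewrite -!scalemxAl -scalemxAr scalerA -exprS.
Qed.

End Words.

(** * The objective function and the two bounds involving [theta] *)

Section Objective.
Variables (R : realType) (n : nat).
Implicit Types (A B C : 'M[maxtimes R]_n) (x : 'cV[maxtimes R]_n).

Lemma rho_rank1_le A x t : regular x ->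
  (rho A (x *m mconj x) <= t) <-> entrywise_le ((A + mconj A) *m x) (t *: x).
Proof.
move=> xreg; rewrite mt_add_le.
(* The entries [x_i / x_j] are reciprocally symmetric, so both traces in [rho] involve the same
   rank-one matrix. *)
have -> : mconj (x *m mconj x) = x *m mconj x.
  apply/matrixP => i j.
  by rewrite !mxE !big_ord1 !mxE mt_invM mt_invK mulrC.
(* By cyclicity the trace is the scalar [mconj x *m M *m x], a maximum of terms
   [(M *m x) i 0 / x i 0], each compared with [t] separately. *)
have quad M : \tr (x *m mconj x *m M) <= t <-> entrywise_le (M *m x) (t *: x).
  rewrite mxtrace_mulC mulmxA mxtrace_mulC trace_mx11 mxE.
  split=> h.
    move=> i j; rewrite ord1 [X in _ <= X]mxE.
    rewrite -(@mt_le_mul2r _ (mt_inv (x i 0))) ?mt_inv_neq0 //.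
    rewrite -mulrA [x i 0 * _]mulrC mt_mulVx // mulr1.
    apply: le_trans h.
    rewrite mulrC; have := mulmx_entry_le (mconj x) (M *m x) 0 i 0.
    by rewrite !mxE.
  apply: mt_sum_le => i _; rewrite [mconj x _ _]mxE.
  rewrite -(@mt_le_mul2r _ (x i 0)) // mulrC mulrA [x i 0 * _]mulrC.
  by rewrite mt_mulVx // mul1r; have := h i 0; rewrite [X in _ <= X]mxE.
rewrite [X in _ && (X <= t)]mxtrace_mulC mulmxDl; split.
  by move=> /andP[/quad h1 /quad h2]; apply/entrywise_add_le.
by move=> /entrywise_add_le[/quad h1 /quad h2]; apply/andP.
Qed.

(** Feasibility gives [C ^+ i *m x <= x], so each block costs at most one factor [t], whatever its
    exponent. *)
Lemma block_prod_subeigen B C x t (e : seq nat) :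
  entrywise_le (B *m x) (t *: x) -> entrywise_le (C *m x) x ->
  entrywise_le ((\prod_(i <- e) (B *m C ^+ i)) *m x) (t ^+ size e *: x).
Proof.
move=> Bx Cx; elim: e => [|i e IH].
  by rewrite big_nil mul1mx scale1r => i j.
rewrite big_cons -[_ * _]/(_ *m _) -mulmxA.
apply: entrywise_le_trans (entrywise_leMl _ IH) _.
rewrite -scalemxAr /= exprSr -scalerA; apply: entrywise_leZ.
apply: entrywise_le_trans Bx; rewrite -mulmxA; apply: entrywise_leMl.
by have := @expr_subeigen _ _ C x 1 i; rewrite expr1n !scale1r; apply.
Qed.

(* Compare at an index maximizing the ratio of the eigenvector to [x]. *)
Lemma eigenvalue_le_subeigen B x mu t :
  regular x -> entrywise_le (B *m x) (t *: x) -> mt_eigenvalue B mu -> mu <= t.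
Proof.
move=> xreg Bx [y y0 By].
have [i0 yi0] : exists i, y i 0 != 0.
  apply/existsP; apply: contraNT y0 => /existsPn h.
  by apply/eqP/matrixP => i j; rewrite ord1 mxE; apply/eqP/negPn/h.
pose q i := y i 0 * mt_inv (x i 0).
have [i _ imax] := @Order.TotalTheory.arg_maxP _ _ _ i0 xpredT q isT.
have yq j : y j 0 = q j * x j 0.
  by rewrite /q -mulrA mt_mulVx // mulr1.
(* The maximal ratio dominates a nonzero one, so this entry of [y] can be cancelled below. *)
have yi : y i 0 != 0.
  have := @mt_neq0_le _ _ _ (imax i0 isT).
  by rewrite yq !mt_mul_neq0 mt_inv_neq0 !xreg !andbT; apply.
have yle : entrywise_le y (q i *: x).
  by move=> j k; rewrite ord1 mxE yq mt_leM //; exact: imax.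
rewrite -(mt_le_mul2r _ _ yi).
have -> : mu * y i 0 = (B *m y) i 0 by rewrite By mxE.
apply: le_trans (entrywise_leMl _ yle i 0) _.
rewrite -scalemxAr mxE yq mulrCA mt_leM //.
by have := Bx i 0; rewrite [X in _ <= X]mxE.
Qed.

(** One nonzero entry [y j 0] spreads to all rows, since [mu * y i 0 >= B i j * y j 0] and the right
    side is nonzero. *)
Lemma positive_eigenpair B mu : no_zero_entry B -> mt_eigenvalue B mu ->
  mu != 0 /\ exists2 y : 'cV_n, regular y & B *m y = mu *: y.
Proof.
move=> B0 [y y0 By].
have [j yj] : exists i, y i 0 != 0.
  apply/existsP; apply: contraNT y0 => /existsPn h.
  by apply/eqP/matrixP => i j; rewrite ord1 mxE; apply/eqP/negPn/h.
have muy i : (mu != 0) && (y i 0 != 0).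
  rewrite -mt_mul_neq0; have -> : mu * y i 0 = (B *m y) i 0 by rewrite By mxE.
  by apply: mt_neq0_le (mulmx_entry_le _ _ _ j _) _; rewrite mt_mul_neq0 B0.
split; first by case/andP: (muy j).
by exists y => // i k; rewrite ord1; case/andP: (muy i).
Qed.

Lemma theta_le_subeigen B C x mu t :
  mt_eigenvalue B mu -> regular x ->
  entrywise_le (B *m x) (t *: x) -> entrywise_le (C *m x) x ->
  theta mu B C <= t.
Proof.
move=> Bmu xreg Bx Cx; rewrite mt_add_le (eigenvalue_le_subeigen xreg Bx) //=.
(* Membership in the range is kept because passing from roots to powers needs [k > 0]. *)
rewrite big_seq; apply: mt_sum_le => k.
rewrite mem_index_iota => /andP[k0 _]; apply: mt_sum_le => e _.
rewrite mt_root_le //; apply: (mxtrace_le_subeigen xreg).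
have := @block_prod_subeigen B C x t (map val e) Bx Cx.
by rewrite big_map size_map size_tuple.
Qed.

Lemma mxtrace_block_le_theta B C mu (e : seq nat) :
  mt_eigenvalue B mu -> no_zero_entry B -> e != [::] ->
  (size e + \sum_(i <- e) i <= n)%N ->
  \tr (\prod_(i <- e) (B * C ^+ i)) <= theta mu B C ^+ size e.
Proof.
move=> Bmu B0 e0 se; have k0 : (0 < size e)%N by rewrite lt0n size_eq0.
(* The sum in [theta] excludes all exponents being zero; there the product is [B ^+ size e], and the
   term [mu] bounds its trace. *)
have [s0|s0] := posnP (\sum_(i <- e) i)%N.
  have -> : \prod_(i <- e) (B * C ^+ i) = B ^+ size e.
    move/eqP: s0; rewrite sum_nat_seq_eq0.
    elim: (e) => [|i e' IH] /=; first by rewrite big_nil.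
    by case/andP=> /eqP -> /IH h; rewrite big_cons h mulr1 exprS.
  have [_ [y yreg By]] := positive_eigenpair B0 Bmu.
  apply: le_trans (mt_expr_le _ (mt_le_addl _ _)).
  apply: (mxtrace_le_subeigen yreg); apply: expr_subeigen.
  by rewrite By => i j.
(* As [e] is nonempty, the exponents sum to less than [n], so each fits in ['I_n] and the default
   value of [insubd] below never occurs. *)
have lt_n i : i \in e -> (i < n)%N.
  move=> ie; have : (i <= \sum_(i <- e) i)%N by rewrite (big_rem i ie) leq_addr.
  lia.
have n0 : (0 < n)%N by lia.
pose f : (size e).-tuple 'I_n := map_tuple (fun i => insubd (Ordinal n0) i) (in_tuple e).
have fe : map val f = e.
  rewrite /f /= -map_comp -[RHS]map_id; apply/eq_in_map => i /lt_n ie /=.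
  by rewrite val_insubd ie.
rewrite -mt_root_le //; apply: le_trans (mt_le_addr _ _).
have := @mt_le_sum R _ (index_iota 1 n) xpredT (fun k =>
  \sum_(i : k.-tuple 'I_n | (1 <= \sum_(e <- i) e <= n - k)%N)
    mt_root k (\tr (\prod_(e <- i) (B *m C ^+ e)))) (size e).
(* A positive exponent sum leaves [size e < n], the range of the outer sum. *)
rewrite mem_index_iota k0 => h; apply: le_trans (h _ isT); last by lia.
have := @mt_le_sum R _ (index_enum _)
  (fun i : (size e).-tuple 'I_n => (1 <= \sum_(e <- i) e <= n - size e)%N)
  (fun i => mt_root (size e) (\tr (\prod_(e <- i) (B *m C ^+ e)))) f
  (mem_index_enum _).
have -> : (\sum_(i <- f) i = \sum_(i <- e) i)%N by rewrite -[in RHS]fe big_map.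
have -> : \prod_(i <- f) (B *m C ^+ i) = \prod_(i <- e) (B * C ^+ i).
  by rewrite -[in RHS]fe big_map.
by apply; lia.
Qed.

Lemma Tr_theta_le1 B C mu :
  mt_eigenvalue B mu -> no_zero_entry B -> Tr C <= 1 ->
  Tr (mt_inv (theta mu B C) *: B + C) <= 1.
Proof.
move=> Bmu B0 hC; set th := theta mu B C.
have th0 : th != 0.
  by apply: mt_neq0_le (mt_le_addl _ _) _; case: (positive_eigenpair B0 Bmu).
rewrite /Tr big_seq; apply: mt_sum_le => k.
rewrite mem_index_iota ltnS => hk; apply: mxtrace_expr_add_le => w sw.
(* A word without [B] is a power of [C], controlled by [Tr C <= 1]. Otherwise each block carries one
   inverse of [th], and these cancel the bound [th ^+ size e]. *)
have [e [[_ ->]|[e0 -> se]]] := mxtrace_word (mt_inv th *: B) C w.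
  by apply: le_trans (mxtrace_expr_le_Tr _ _) hC; rewrite sw.
rewrite prod_scale_block mxtraceZ.
rewrite -[X in _ <= X](_ : mt_inv th ^+ size e * th ^+ size e = _).
  by rewrite mt_leM // mxtrace_block_le_theta // -se sw; case/andP: hk.
by rewrite -exprMn mt_mulVx // expr1n.
Qed.

End Objective.

Theorem theorem5 (R : realType) (n : nat) (A C : 'M[maxtimes R]_n)
    (mu : maxtimes R)
    (hB : no_zero_entry (A + mconj A))
    (hmu : is_spectral_radius (A + mconj A) mu)
    (hC : Tr C <= 1) :
  let B := A + mconj A in
  let th := theta mu B C in
  let feasible (x : 'cV[maxtimes R]_n) :=
    regular x /\ entrywise_le (C *m x) x in
  let objective (x : 'cV[maxtimes R]_n) := rho A (x *m mconj x) in
  is_minimum feasible objective th /\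
  (forall x : 'cV[maxtimes R]_n,
     (feasible x /\ objective x = th) <->
     (exists2 u : 'cV[maxtimes R]_n, regular u &
        x = kleene_star (mt_inv th *: B + C) *m u)).
Proof.
move=> B th feasible objective; have [Bmu _] := hmu; rewrite -/B in hB Bmu.
(* [th] dominates the nonzero [mu], so [mt_inv th] is a true inverse. *)
have th0 : th != 0.
  by apply: mt_neq0_le (mt_le_addl _ _) _; case: (positive_eigenpair hB Bmu).
have low x : feasible x -> th <= objective x.
  move=> [xreg Cx]; apply: (theta_le_subeigen Bmu xreg _ Cx).
  by apply/(rho_rank1_le A _ xreg).
(* The solution set is described first, since it also supplies a point where the lower bound [th] is
   attained. *)
have char x : (feasible x /\ objective x = th) <->
    (exists2 u : 'cV_n, regular u &
       x = kleene_star (mt_inv th *: B + C) *m u).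
  have scale : entrywise_le (mt_inv th *: B *m x) x <->
      entrywise_le (B *m x) (th *: x).
    rewrite -scalemxAl; split=> [/(entrywise_leZ th)|/(entrywise_leZ (mt_inv th))].
      by rewrite scalerA mulrC mt_mulVx // scale1r.
    by rewrite !scalerA mt_mulVx // scale1r.
  split=> [[[xreg Cx] ox]|].
    apply/(kleene_star_solutions (Tr_theta_le1 Bmu hB hC)); split=> //.
    rewrite mulmxDl; apply/entrywise_add_le; split=> //.
    by apply/scale/(rho_rank1_le _ _ xreg); rewrite -ox.
  move/(kleene_star_solutions (Tr_theta_le1 Bmu hB hC)) => [xreg].
  rewrite mulmxDl => /entrywise_add_le[/scale Bx Cx].
  have fx : feasible x by [].
  split=> //; apply/le_anti; rewrite low // andbT.
  by apply/(rho_rank1_le A _ xreg).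
split=> //; split=> //.
pose D := mt_inv th *: B + C.
(* Any regular parameter gives a minimizer; the all-ones vector is taken. *)
have [|fx ox] := proj2 (char (kleene_star D *m const_mx 1)).
  by exists (const_mx 1) => // i j; rewrite mxE oner_neq0.
by exists (kleene_star D *m const_mx 1).
Qed.
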